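(* Let $\Lambda$ be an ordered [or unordered] rooted tree of size $k$, and let $\Lambda'$ be an ordered [or unordered] rooted tree of size $m$, where $1\le m\le k$. Let $\hat p_{k,\Lambda}:=\mathbb{P}(\Lambda_k=\Lambda)$ and $\hat p_{m,\Lambda'}:=\mathbb{P}(\Lambda_m=\Lambda')$, and let $\hat q^{\Lambda}_{\Lambda'}$ be the number of subtrees of $\Lambda$ that are copies of $\Lambda'$. Let $$\hat\beta(k,m):=\frac{k^2+km+m^2+k+m}{k(k+1)m(m+1)(k+m+1)}.$$ Let $\hat X_n^{\Lambda}$ and $\hat X_n^{\Lambda'}$ be the numbers of subtrees of the random recursive tree $\Lambda_n$ that are copies of $\Lambda$ and $\Lambda'$, respectively. If $n>k+m$, then $$\mathrm{Cov}(\hat X_n^{\Lambda},\hat X_n^{\Lambda'})=n\,\hat\sigma_{\Lambda,\Lambda'},$$ where $$\hat\sigma_{\Lambda,\Lambda'}:=\frac{1}{k(k+1)}\,\hat q^{\Lambda}_{\Lambda'}\,\hat p_{k,\Lambda}-\hat\beta(k,m)\,\hat p_{k,\Lambda}\,\hat p_{m,\Lambda'}.$$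
   Context: Random recursive tree $\Lambda_n$: start with a root labelled $1$; for $i=2,\dots,n$, node $i$ is attached as a child of a uniformly random node among $1,\dots,i-1$ (independently of earlier choices). It is regarded as an ordered rooted tree by ordering the children of each node by increasing labels from left to right and then ignoring the labels, or as an unordered rooted tree by ignoring also the ordering; the statement holds in each of the two versions (with all trees, probabilities and copies interpreted in the same version). The size of a tree is its number of nodes. A subtree always means a fringe subtree: a node together with all its descendants; ''copy'' means isomorphic as an ordered [respectively unordered] rooted tree. *)

(* Defs.v *)
From HB Require Import structures.
From mathcomp Require Import all_boot all_order all_algebra.

Set Implicit Arguments.
Unset Strict Implicit.
Unset Printing Implicit Defensive.

Import GRing.Theory.
Local Open Scope ring_scope.

(* An ordered rooted tree is the list, from left to right, of the trees rooted
   at the children of its root. *)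
Inductive rtree := Node of seq rtree.

Lemma rtree_nested_ind (P : rtree -> Prop) :
  (forall ts, foldr (fun t Q => P t /\ Q) True ts -> P (Node ts)) ->
  forall t, P t.
Proof.
move=> H; fix IH 1; case=> ts; apply: H.
by elim: ts => [|t ts IHts] //=; split.
Qed.

Fixpoint rtree_encode (t : rtree) : GenTree.tree void :=
  let: Node ts := t in GenTree.Node 0 (map rtree_encode ts).

Fixpoint rtree_decode (t : GenTree.tree void) : rtree :=
  if t is GenTree.Node _ ts then Node (map rtree_decode ts) else Node [::].

Lemma rtree_encodeK : cancel rtree_encode rtree_decode.
Proof.
apply: rtree_nested_ind => ts /= IH; congr Node; rewrite -map_comp.
by elim: ts IH => //= t ts IHts [-> /IHts ->].
Qed.

HB.instance Definition _ := Countable.copy rtree (can_type rtree_encodeK).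

Lemma rtree_mem_ind (P : rtree -> Prop) :
  (forall ts, {in ts, forall t, P t} -> P (Node ts)) -> forall t, P t.
Proof.
move=> H; apply: rtree_nested_ind => ts IH; apply: H.
elim: ts IH => [|t ts IHts] //= [Pt /IHts Pts] u; rewrite inE.
by case/predU1P => [->|/Pts].
Qed.

Fixpoint rtree_size (t : rtree) : nat :=
  let: Node ts := t in (sumn (map rtree_size ts)).+1.

(* One entry for each node of [t]: the tree formed by it and its descendants. *)
Fixpoint subtrees (t : rtree) : seq rtree :=
  let: Node ts := t in t :: flatten (map subtrees ts).

(* Isomorphism of the underlying unordered rooted trees: the children of the
   two roots can be matched so that the branches they carry are isomorphic. *)
Fixpoint uiso (t u : rtree) : bool :=
  let: Node ts := t in let: Node us := u in
  has (all2 uiso ts) (permutations us).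

Lemma uisoP ts us :
  reflect (exists2 vs, perm_eq vs us & all2 uiso ts vs)
          (uiso (Node ts) (Node us)).
Proof.
by apply: (iffP hasP) => -[vs Hvs]; exists vs => //; move: Hvs;
  rewrite mem_permutations.
Qed.

Lemma all2_cat_l (T : Type) (r : rel T) s1 s2 us : all2 r (s1 ++ s2) us ->
  exists us1 us2, [/\ us = us1 ++ us2, all2 r s1 us1 & all2 r s2 us2].
Proof.
elim: s1 us => [|x s1 IH] us /=; first by exists [::], us.
case: us => [|u us] // /andP[rxu /IH[us1 [us2 [-> H1 H2]]]].
by exists (u :: us1), us2; split=> //=; rewrite rxu.
Qed.

Lemma all2_cat2 (T : Type) (r : rel T) s1 s2 u1 u2 :
  all2 r s1 u1 -> all2 r s2 u2 -> all2 r (s1 ++ s2) (u1 ++ u2).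
Proof.
elim: s1 u1 => [|x s1 IH] [|u u1] //= /andP[-> H1] H2.
exact: IH.
Qed.

Lemma all2_perm_l (T : eqType) (r : rel T) ts ts' us :
  perm_eq ts ts' -> all2 r ts us -> exists2 us', perm_eq us' us & all2 r ts' us'.
Proof.
pose P s := exists2 us', perm_eq us' us & all2 r s us'.
move=> tsE tsus; suff : P ts' by [].
apply: (catCA_perm_ind _ tsE); last by exists us.
move=> s1 s2 s3 [us' + /all2_cat_l[u1 [u' [us'E H1 /all2_cat_l]]]].
move=> + [u2 [u3 [u'E H2 H3]]]; rewrite us'E u'E => usP.
exists (u2 ++ u1 ++ u3); last by do 2?apply: all2_cat2.
by rewrite perm_catCA.
Qed.

Lemma uiso_refl : reflexive uiso.
Proof.
elim/rtree_mem_ind => ts IH; apply/uisoP; exists ts => //.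
elim: ts IH => //= t ts IHts IH; rewrite IH ?mem_head //=.
by apply: IHts => u uts; apply: IH; rewrite inE uts orbT.
Qed.

Lemma uiso_symW t u : uiso t u -> uiso u t.
Proof.
elim/rtree_mem_ind: t u => ts IH [us] /uisoP[vs vsus tsvs]; apply/uisoP.
suff /(all2_perm_l vsus) : all2 uiso vs ts by [].
elim: ts vs IH tsvs {vsus} => [|t ts IHts] [|v vs] //= IH /andP[tv tsvs].
rewrite IH ?mem_head //=; apply: IHts => // x xts y.
by apply: IH; rewrite inE xts orbT.
Qed.

Lemma uiso_sym : symmetric uiso.
Proof. by move=> t u; apply/idP/idP; apply: uiso_symW. Qed.

Lemma uiso_trans : transitive uiso.
Proof.
move=> u t w; elim/rtree_mem_ind: t u w => ts IH [us] [ws].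
move=> /uisoP[vs vsus tsvs] /uisoP[xs xsws usxs].
have [ys ysxs vsys] : exists2 ys, perm_eq ys xs & all2 uiso vs ys.
  by apply: all2_perm_l usxs; rewrite perm_sym.
apply/uisoP; exists ys; first exact: perm_trans ysxs xsws.
elim: ts vs ys IH tsvs vsys {vsus ysxs} => [|t ts IHts] [|v vs] [|y ys] //= IH.
move=> /andP[tv tsvs] /andP[vy vsys].
rewrite (IH t _ v) ?mem_head //=; apply: IHts tsvs vsys => x xts.
by apply: IH; rewrite inE xts orbT.
Qed.

Variant tree_version := Ordered | Unordered.

(* An unordered rooted tree is given by any of its orderings, and is compared
   with other trees by [uiso] only. *)
Definition tree_iso (v : tree_version) : rel rtree :=
  match v with Ordered => eq_op | Unordered => uiso end.

Lemma tree_iso_equiv v : equivalence_rel (tree_iso v).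
Proof.
case: v => /= t u w; first by rewrite eqxx; split=> // /eqP->.
split=> [|tu]; first exact: uiso_refl.
by apply/idP/idP; apply: uiso_trans; rewrite // uiso_sym.
Qed.

Definition num_copies (v : tree_version) (s t : rtree) : nat :=
  count (tree_iso v s) (subtrees t).

Inductive ltree := LNode of nat & seq ltree.

(* The new node becomes the rightmost child, so when labels are attached in
   increasing order siblings are sorted by label. *)
Fixpoint attach (parent child : nat) (t : ltree) : ltree :=
  let: LNode l ts := t in
  if l == parent then LNode l (rcons ts (LNode child [::]))
  else LNode l (map (attach parent child) ts).

Fixpoint erase_labels (t : ltree) : rtree :=
  let: LNode _ ts := t in Node (map erase_labels ts).

(* [attachments n] is 'I_1 * ... * 'I_n: the parents chosen by the nodes
   2, ..., n.+1, the parent j.+1 being encoded by j. The uniform law on this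
   product makes the choices independent and uniform. *)
Fixpoint attachments (n : nat) : finType :=
  if n is n'.+1 then (attachments n' * 'I_n'.+1)%type else unit.

Fixpoint recursive_tree (n : nat) : attachments n -> ltree :=
  match n return attachments n -> ltree with
  | 0 => fun=> LNode 1 [::]
  | n'.+1 => fun w => attach w.2.+1 n'.+2 (recursive_tree w.1)
  end.

(* The random recursive tree with n nodes, for n >= 1. *)
Definition rrt (n : nat) (w : attachments n.-1) : rtree :=
  erase_labels (recursive_tree w).

(* Probability, expectation and covariance for the uniform law on a finite
   sample space. *)
Section Uniform.
Variables (R : realFieldType) (Omega : finType).

Definition prob (A : pred Omega) : R := #|A|%:R / #|Omega|%:R.

Definition expect (X : Omega -> R) : R := (\sum_w X w) / #|Omega|%:R.

Definition cov (X Y : Omega -> R) : R :=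
  expect (fun w => (X w - expect X) * (Y w - expect Y)).

End Uniform.

Section Fringe.
Variables (R : realFieldType) (v : tree_version).

Definition rrt_prob (n : nat) (t : rtree) : R :=
  prob R [pred w : attachments n.-1 | tree_iso v (@rrt n w) t].

Definition rrt_copies (n : nat) (t : rtree) (w : attachments n.-1) : R :=
  (num_copies v t (@rrt n w))%:R.

Definition beta (k m : nat) : R :=
  (k ^ 2 + k * m + m ^ 2 + k + m)%N%:R
  / (k * k.+1 * m * m.+1 * (k + m + 1))%N%:R.

Definition sigma (k m : nat) (t t' : rtree) : R :=
  (k * k.+1)%N%:R^-1 * (num_copies v t' t)%:R * rrt_prob k t
  - beta k m * rrt_prob k t * rrt_prob m t'.

End Fringe.

(* Main.v *)
Require Import Defs.
From mathcomp Require Import all_boot all_order all_algebra.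
From mathcomp Require Import ring zify.

Set Implicit Arguments.
Unset Strict Implicit.
Unset Printing Implicit Defensive.

Import GRing.Theory Num.Theory.
Local Open Scope ring_scope.

(** The counts are treated as values of additive functionals, without looking
    at the shape of the trees that are counted. For a real function [f] on
    trees (a toll), let F(t) be the sum of [f] over all fringe subtrees of
    [t]; the number of copies of a tree is F for the indicator [f] of its
    isomorphism class, in the ordered and in the unordered version alike.
    Write E_n for the mean over the random recursive tree with n nodes.

    The tree with n+1 nodes arises from the one with n nodes by attaching a
    leaf to a uniform node. Of the n choices of that node, those inside a
    fringe subtree s let s grow, the others leave s alone, and in all cases
    one fringe subtree, the new leaf, is added. If [f] vanishes outside size k
    and Lf(s) is the sum of [f] over the trees grown from s (so Lf lives on
    size k-1), this gives
      n E_(n+1) F_f = (n-k) E_n F_f + E_n F_(Lf) + n f(leaf),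
    and E_(k-1) Lf = (k-1) E_k f for k > 1. Induction on k, then on n, yields
    E_n F_f = n / (k(k+1)) E_k f for n > k ([mean_fringe_sum]). The induction
    on n needs no initial value, as the factor n-k vanishes at n = k.

    In the same way let D(t) be the sum of f(s) g(s') over the ordered pairs
    of disjoint fringe subtrees s, s' of [t], where [f] lives on size k and
    [g] on size m. Since s and s' are disjoint, the new leaf extends at most
    one of them, so the recursion for E_n D involves, besides E_n D with the
    factor n-k-m, only the disjoint sums for (Lf, g) and (f, Lg) and, when the
    new leaf is itself a member of the pair, the means E_n F_f and E_n F_g.
    It is solved for all n > k+m, again without initial value
    ([mean_disjoint_sum]), and gives
      E_n D = (n^2 / (k(k+1)m(m+1)) - n beta(k,m)) E_k f E_m g.

    Finally F_f F_g is D plus the sum over nested pairs. For m <= k the latter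
    is the additive functional with toll f F_g, which lives on size k and so
    has mean n / (k(k+1)) E_k (f F_g). For the two indicators, f F_g is the
    indicator of one tree times the number of copies of the other in it.
    Subtracting the product of the means cancels the n^2 term. *)

(** * Growing a tree by one leaf *)

Lemma rtree_forest_ind (P : rtree -> Prop) (Q : seq rtree -> Prop) :
  (forall ts, Q ts -> P (Node ts)) -> Q [::] ->
  (forall t ts, P t -> Q ts -> Q (t :: ts)) ->
  (forall t, P t) /\ (forall ts, Q ts).
Proof.
move=> HP Q0 HQ.
have Pt : forall t, P t.
  elim/rtree_mem_ind=> ts IH; apply: HP.
  elim: ts IH => // t ts IHts IH; apply: HQ; first exact: IH (mem_head _ _).
  by apply: IHts => u uts; apply: IH; rewrite inE uts orbT.
by split=> //; elim=> // t ts; apply: HQ.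
Qed.

Lemma ltree_forest_ind (P : ltree -> Prop) (Q : seq ltree -> Prop) :
  (forall l Ls, Q Ls -> P (LNode l Ls)) -> Q [::] ->
  (forall L Ls, P L -> Q Ls -> Q (L :: Ls)) -> forall L, P L.
Proof.
move=> HP Q0 HQ; fix IH 1; case=> l Ls; apply: HP.
by elim: Ls => // L Ls IHLs; apply: HQ.
Qed.

Definition leaf := Node [::].

(** Parametrised by the function that grows one tree, so that the nested
    recursion in [grow] is accepted. *)
Definition grow_one (g : rtree -> seq rtree) :=
  fix loop ts := if ts is t :: ts' then
    map (cons^~ ts') (g t) ++ map (cons t) (loop ts') else [::].

(** All trees obtained from [t] by attaching a leaf as rightmost child of some
    node, with one entry for each node, in preorder. *)
Fixpoint grow (t : rtree) : seq rtree :=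
  let: Node ts := t in
  Node (rcons ts leaf) :: map Node (grow_one grow ts).

Local Notation grow_forest := (grow_one grow).

Definition forest_size (ts : seq rtree) := sumn (map rtree_size ts).

Lemma size_grow_and_forest :
  (forall t, size (grow t) = rtree_size t) /\
  (forall ts, size (grow_forest ts) = forest_size ts).
Proof.
apply: rtree_forest_ind => // [ts|t ts].
  by rewrite /= size_map => ->.
by rewrite /= size_cat !size_map /forest_size /= => -> ->.
Qed.

Lemma size_grow t : size (grow t) = rtree_size t.
Proof. exact: size_grow_and_forest.1. Qed.

Lemma size_grow_forest ts : size (grow_forest ts) = forest_size ts.
Proof. exact: size_grow_and_forest.2. Qed.

Lemma rtree_size_grow t u : u \in grow t -> rtree_size u = (rtree_size t).+1.
Proof.
move: t u; pose Q ts := forall us, us \in grow_forest ts ->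
  forest_size us = (forest_size ts).+1.
suff [//] : (forall t u, u \in grow t -> rtree_size u = (rtree_size t).+1)
  /\ (forall ts, Q ts).
apply: rtree_forest_ind => // [ts IH u|t ts IHt IHts us].
  rewrite inE => /predU1P[->|/mapP[us /IH us_ts ->]] /=.
    by rewrite map_rcons sumn_rcons addn1.
  by rewrite -/(forest_size us) us_ts.
rewrite /= mem_cat => /orP[] /mapP[x]; rewrite /forest_size /=.
  by move=> /IHt xt ->; rewrite /= xt.
by move=> /IHts; rewrite /forest_size => xts ->; rewrite /= xts addnS.
Qed.

Lemma rtree_size_gt0 t : (0 < rtree_size t)%N. Proof. by case: t. Qed.

(** * Label-free description of the recursive tree *)

Fixpoint labels (L : ltree) : seq nat :=
  let: LNode l Ls := L in l :: flatten (map labels Ls).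

Lemma attach_notin p c L : p \notin labels L -> attach p c L = L.
Proof.
move: L; apply: (@ltree_forest_ind _ (fun Ls => p \notin flatten (map labels Ls) ->
  map (attach p c) Ls = Ls)) => //= [l Ls IH|L Ls IHL IHLs].
  by rewrite inE negb_or eq_sym => /andP[/negPf-> /IH->].
by rewrite mem_cat negb_or => /andP[/IHL-> /IHLs->].
Qed.

Lemma map_attach_notin p c Ls :
  p \notin flatten (map labels Ls) -> map (attach p c) Ls = Ls.
Proof.
elim: Ls => //= L Ls IH.
by rewrite mem_cat negb_or => /andP[/attach_notin-> /IH->].
Qed.

(** Both sides list the nodes in preorder. Distinct labels ensure that [attach]
    changes the tree at a single place, the unique node with label [p]. *)
Lemma erase_attach c L : uniq (labels L) ->
  [seq erase_labels (attach p c L) | p <- labels L] = grow (erase_labels L).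
Proof.
move: L; apply: (@ltree_forest_ind _ (fun Ls => uniq (flatten (map labels Ls)) ->
  [seq map erase_labels (map (attach p c) Ls) | p <- flatten (map labels Ls)]
  = grow_forest (map erase_labels Ls))) => //= [l Ls IH|L Ls IHL IHLs].
  move=> /andP[lLs /IH <-]; rewrite eqxx /= map_rcons -map_comp.
  congr (_ :: _); apply/eq_in_map => p pLs /=.
  by case: eqP lLs => [->|]; rewrite ?pLs.
rewrite cat_uniq map_cat => /and3P[uL /hasPn LLs uLs].
rewrite -IHL // -IHLs // -!map_comp; congr (_ ++ _); apply/eq_in_map => p pin /=.
  by rewrite map_attach_notin //; apply: contraL pin => /LLs.
by rewrite attach_notin //; apply: LLs.
Qed.

Lemma labels_attach p c L : uniq (labels L) -> p \in labels L ->
  perm_eq (labels (attach p c L)) (c :: labels L).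
Proof.
move: L; apply: (@ltree_forest_ind _ (fun Ls => uniq (flatten (map labels Ls)) ->
  p \in flatten (map labels Ls) ->
  perm_eq (flatten (map labels (map (attach p c) Ls)))
          (c :: flatten (map labels Ls)))) => //= [l Ls IH|L Ls IHL IHLs].
  move=> /andP[lLs uLs]; rewrite inE; case: (eqVneq l p) => [<- _|lp] /=.
    rewrite map_rcons -cats1 flatten_cat /=.
    by apply/permP => a; rewrite /= count_cat /=; lia.
  move=> pLs; have /permP pE := IH uLs pLs.
  by apply/permP => a /=; rewrite pE /=; lia.
rewrite cat_uniq mem_cat => /and3P[uL /hasPn LLs uLs].
have [pL _|pL /= pLs] := boolP (p \in labels L).
  rewrite map_attach_notin; last by apply: contraL pL => /LLs.
  by rewrite -cat_cons perm_cat2r IHL.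
rewrite attach_notin //; have /permP pE := IHLs uLs pLs.
by apply/permP => a; rewrite /= !count_cat pE /=; lia.
Qed.

Lemma labels_recursive_tree n (w : attachments n) :
  perm_eq (labels (recursive_tree w)) (iota 1 n.+1).
Proof.
elim: n w => [|n IH] //= [w i] /=.
have lw := IH w; have uw : uniq (labels (recursive_tree w)).
  by rewrite (perm_uniq lw) iota_uniq.
have iw : i.+1 \in labels (recursive_tree w).
  by rewrite (perm_mem lw) mem_iota; have := ltn_ord i; lia.
apply: perm_trans (labels_attach n.+2 uw iw) _.
apply: (@perm_trans _ (n.+2 :: iota 1 n.+1)); first by rewrite perm_cons.
rewrite -[1%N :: _]/(iota 1 n.+2) -(addn1 n.+1) iotaD cats1 perm_sym.
by rewrite perm_rcons addnC.
Qed.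

(** * Invariance under isomorphism *)

(** A statistic computed by adding up a contribution [c] of each fringe
    subtree is unchanged when children are permuted and branches replaced by
    isomorphic ones. It covers both the size and the number of copies. *)
Lemma uiso_invariant (c h : rtree -> nat) :
  (forall ts, h (Node ts) = (c (Node ts) + sumn (map h ts))%N) ->
  (forall t u, uiso t u -> c t = c u) ->
  forall t u, uiso t u -> h t = h u.
Proof.
move=> hN c_iso; elim/rtree_mem_ind=> ts IH [us] tu.
rewrite !hN (c_iso _ _ tu); congr (_ + _)%N.
case/uisoP: tu => vs /(perm_map h)/perm_sumn <-.
elim: ts vs IH => [|t ts IHts] [|v vs] //= IH /andP[tv tsvs].
rewrite (IH t _ v) ?mem_head // (IHts vs) // => x xts.
by apply: IH; rewrite inE xts orbT.
Qed.

Lemma rtree_size_iso v t u : tree_iso v t u -> rtree_size t = rtree_size u.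
Proof.
by case: v => /= [/eqP->//|]; apply: (@uiso_invariant (fun=> 1%N)).
Qed.

Lemma tree_iso_sym v : symmetric (tree_iso v).
Proof. by case: v => t u; [apply: eq_sym | apply: uiso_sym]. Qed.

Lemma num_copies_iso v s t u :
  tree_iso v t u -> num_copies v s t = num_copies v s u.
Proof.
case: v => /= [/eqP->//|]; apply: (@uiso_invariant (fun t => uiso s t)).
  by move=> ts; rewrite /num_copies /= count_flatten -map_comp.
move=> {}t {}u tu; congr nat_of_bool.
by apply/idP/idP => /uiso_trans; apply; rewrite // uiso_sym.
Qed.

(** Closes the side conditions of [field], in which sums of images of natural
    numbers must be recognised as images of positive numbers. *)
Ltac nonzero_natr := by rewrite -1?[1]/(1%:R) -?natrD ?pnatr_eq0 ?addn1.

(** * Means over the random recursive tree *)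

Section Moments.
Variable R : realFieldType.
Implicit Types f g : rtree -> R.

Definition mean n f : R := expect (fun w => f (@rrt n w)).

Lemma card_attachments_neq0 n : #|attachments n|%:R != 0 :> R.
Proof.
rewrite pnatr_eq0 -lt0n; elim: n => [|n IH] /=; first by rewrite card_unit.
by rewrite card_prod card_ord muln_gt0 IH.
Qed.

Lemma mean1 f : mean 1 f = f leaf.
Proof.
rewrite /mean /expect /= card_unit divr1 (bigD1 tt) //= big1 ?addr0 //.
Qed.

(** The parent of the new node is uniform among n nodes and independent of the
    tree built so far, so averaging over it gives the entries of [grow] with
    equal weights. *)
Lemma mean_step n f : (0 < n)%N ->
  n%:R * mean n.+1 f = mean n (fun t => \sum_(u <- grow t) f u).
Proof.
case: n => // n _; rewrite /mean /expect /rrt /=.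
have nn0 : n.+1%:R != 0 :> R by rewrite pnatr_eq0.
have sumE (w : attachments n) :
    \sum_(u <- grow (erase_labels (recursive_tree w))) f u =
    \sum_(i < n.+1) f (erase_labels (attach i.+1 n.+2 (recursive_tree w))).
  have lw := labels_recursive_tree w.
  rewrite -(@erase_attach n.+2); last by rewrite (perm_uniq lw) iota_uniq.
  rewrite big_map (perm_big _ lw) /= -[1%N :: _]/(iota 1 n.+1).
  rewrite (iotaDl 1 0) big_map /= -[0%N :: _]/(index_iota 0 n.+1).
  by rewrite big_mkord.
rewrite (eq_bigr _ (fun w _ => sumE w)) pair_bigA /= card_prod card_ord natrM.
set S := \sum_p _; have c0 := card_attachments_neq0 n.
by field; rewrite c0 nat1r nn0.
Qed.

Lemma eq_mean n f g : (0 < n)%N -> (forall t, rtree_size t = n -> f t = g t) ->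
  mean n f = mean n g.
Proof.
case: n => // n _ fg; rewrite /mean /expect; congr (_ / _).
apply: eq_bigr => w _; apply: fg; rewrite /rrt /=.
elim: n w => //= n IH [w i] /=.
have lw := labels_recursive_tree w.
suff /rtree_size_grow -> : erase_labels (attach i.+1 n.+2 (recursive_tree w))
  \in grow (erase_labels (recursive_tree w)) by rewrite IH.
rewrite -(@erase_attach n.+2); last by rewrite (perm_uniq lw) iota_uniq.
apply: (map_f (fun p => erase_labels (attach p _ _))).
by rewrite (perm_mem lw) mem_iota; have := ltn_ord i; lia.
Qed.

Lemma meanD n f g : mean n (fun t => f t + g t) = mean n f + mean n g.
Proof. by rewrite /mean /expect big_split mulrDl. Qed.

Lemma meanZ n a f : mean n (fun t => a * f t) = a * mean n f.
Proof. by rewrite /mean /expect -mulr_sumr mulrA. Qed.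

Lemma mean0 n : mean n (fun=> 0) = 0.
Proof. by rewrite /mean /expect big1 ?mul0r. Qed.

(** * Sums over fringe subtrees *)

Definition fringe_sum f t : R := \sum_(s <- subtrees t) f s.
Definition forest_sum f ts : R := \sum_(t <- ts) fringe_sum f t.

Lemma fringe_sum_Node f ts :
  fringe_sum f (Node ts) = f (Node ts) + forest_sum f ts.
Proof. by rewrite /fringe_sum /= big_cons big_flatten /forest_sum big_map. Qed.

Lemma forest_sum_cons f t ts :
  forest_sum f (t :: ts) = fringe_sum f t + forest_sum f ts.
Proof. by rewrite /forest_sum big_cons. Qed.

Lemma forest_sum_nil f : forest_sum f [::] = 0. Proof. exact: big_nil. Qed.

Lemma forest_sum_rcons_leaf f ts :
  forest_sum f (rcons ts leaf) = forest_sum f ts + f leaf.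
Proof.
rewrite /forest_sum -cats1 big_cat big_seq1 fringe_sum_Node forest_sum_nil.
by rewrite addr0.
Qed.

Definition grow_toll f t : R := \sum_(u <- grow t) f u.
Definition size_toll f t : R := (rtree_size t)%:R * f t.

Lemma sum_grow_const t (c : R) : \sum_(u <- grow t) c = (rtree_size t)%:R * c.
Proof. by rewrite big_const_seq count_predT size_grow iter_addr_0 mulr_natl. Qed.

Lemma sum_grow_forest_const ts (c : R) :
  \sum_(u <- grow_forest ts) c = (forest_size ts)%:R * c.
Proof.
by rewrite big_const_seq count_predT size_grow_forest iter_addr_0 mulr_natl.
Qed.

Lemma sum_grow_forest_cons t ts (f : seq rtree -> R) :
  \sum_(us <- grow_forest (t :: ts)) f us =
  \sum_(u <- grow t) f (u :: ts) + \sum_(us <- grow_forest ts) f (t :: us).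
Proof. by rewrite /= big_cat !big_map. Qed.

Lemma sum_grow_Node ts f :
  \sum_(u <- grow (Node ts)) f u =
  f (Node (rcons ts leaf)) + \sum_(us <- grow_forest ts) f (Node us).
Proof. by rewrite /= big_cons big_map. Qed.

Lemma rtree_size_Node ts :
  (rtree_size (Node ts))%:R = 1 + (forest_size ts)%:R :> R.
Proof. by rewrite nat1r. Qed.

Lemma forest_size_cons t ts :
  (forest_size (t :: ts))%:R = (rtree_size t)%:R + (forest_size ts)%:R :> R.
Proof. by rewrite -natrD. Qed.

(** A fringe subtree of a grown tree is a subtree [s] of [t] that has itself
    grown, or one left alone because the leaf went to one of the
    [rtree_size t - rtree_size s] nodes outside it, or the new leaf. *)
Lemma fringe_sum_grow f :
  (forall t, \sum_(u <- grow t) fringe_sum f u =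
     fringe_sum (grow_toll f) t + (rtree_size t)%:R * (fringe_sum f t + f leaf)
     - fringe_sum (size_toll f) t) /\
  (forall ts, \sum_(us <- grow_forest ts) forest_sum f us =
     forest_sum (grow_toll f) ts
     + (forest_size ts)%:R * (forest_sum f ts + f leaf)
     - forest_sum (size_toll f) ts).
Proof.
apply: rtree_forest_ind => [ts IH||t ts IHt IHts].
- rewrite sum_grow_Node !fringe_sum_Node forest_sum_rcons_leaf.
  under eq_bigr do rewrite fringe_sum_Node.
  rewrite big_split IH /= /grow_toll sum_grow_Node /size_toll rtree_size_Node.
  ring.
- by rewrite /= big_nil !forest_sum_nil mul0r; ring.
- rewrite sum_grow_forest_cons.
  under eq_bigr do rewrite forest_sum_cons.
  rewrite big_split IHt sum_grow_const.
  under eq_bigr do rewrite forest_sum_cons.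
  rewrite big_split IHts sum_grow_forest_const !forest_sum_cons.
  rewrite forest_size_cons /=; ring.
Qed.

(** * Pairs of disjoint fringe subtrees *)

(** Two fringe subtrees are either disjoint or nested. This toll collects at
    [s] the nested pairs whose larger member is [s], the pair [(s, s)] being
    counted once. *)
Definition nested_toll f g s : R :=
  f s * fringe_sum g s + fringe_sum f s * g s - f s * g s.
(** The sum of [f s * g s'] over the ordered pairs of disjoint fringe subtrees,
    defined as what is left of the product of the two sums after removing the
    nested pairs. *)
Definition disjoint_sum f g t : R :=
  fringe_sum f t * fringe_sum g t - fringe_sum (nested_toll f g) t.
Definition forest_disjoint_sum f g ts : R :=
  forest_sum f ts * forest_sum g ts - forest_sum (nested_toll f g) ts.

(** The whole tree is disjoint from none of its fringe subtrees. *)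
Lemma disjoint_sum_Node f g ts :
  disjoint_sum f g (Node ts) = forest_disjoint_sum f g ts.
Proof.
rewrite /disjoint_sum /forest_disjoint_sum !fringe_sum_Node /nested_toll.
by rewrite !fringe_sum_Node; ring.
Qed.

Lemma forest_disjoint_sum_cons f g t ts : forest_disjoint_sum f g (t :: ts) =
  disjoint_sum f g t + forest_disjoint_sum f g ts
  + fringe_sum f t * forest_sum g ts + forest_sum f ts * fringe_sum g t.
Proof. by rewrite /disjoint_sum /forest_disjoint_sum !forest_sum_cons; ring. Qed.

Lemma forest_disjoint_sum_rcons_leaf f g ts :
  forest_disjoint_sum f g (rcons ts leaf) =
  forest_disjoint_sum f g ts
  + forest_sum f ts * g leaf + f leaf * forest_sum g ts.
Proof.
rewrite /forest_disjoint_sum !forest_sum_rcons_leaf /nested_toll.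
by rewrite !fringe_sum_Node !forest_sum_nil; ring.
Qed.

(** A disjoint pair of fringe subtrees of a grown tree either comes from a
    disjoint pair of [t], of which the leaf extends one member or none, or
    consists of the new leaf and a subtree that the leaf was not attached
    to. *)
Lemma disjoint_sum_grow f g :
  (forall t, \sum_(u <- grow t) disjoint_sum f g u =
     disjoint_sum (grow_toll f) g t + disjoint_sum f (grow_toll g) t
     + (rtree_size t)%:R * disjoint_sum f g t
     - disjoint_sum (size_toll f) g t - disjoint_sum f (size_toll g) t
     + f leaf * ((rtree_size t)%:R * fringe_sum g t - fringe_sum (size_toll g) t)
     + g leaf * ((rtree_size t)%:R * fringe_sum f t - fringe_sum (size_toll f) t)) /\
  (forall ts, \sum_(us <- grow_forest ts) forest_disjoint_sum f g us =
     forest_disjoint_sum (grow_toll f) g ts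
     + forest_disjoint_sum f (grow_toll g) ts
     + (forest_size ts)%:R * forest_disjoint_sum f g ts
     - forest_disjoint_sum (size_toll f) g ts
     - forest_disjoint_sum f (size_toll g) ts
     + f leaf * ((forest_size ts)%:R * forest_sum g ts - forest_sum (size_toll g) ts)
     + g leaf * ((forest_size ts)%:R * forest_sum f ts - forest_sum (size_toll f) ts)).
Proof.
apply: rtree_forest_ind => [ts IH||t ts IHt IHts].
- rewrite sum_grow_Node !disjoint_sum_Node forest_disjoint_sum_rcons_leaf.
  under eq_bigr do rewrite disjoint_sum_Node.
  rewrite IH !fringe_sum_Node /size_toll rtree_size_Node; ring.
- by rewrite /= big_nil /forest_disjoint_sum !forest_sum_nil; ring.
- have [tG tsG] := fringe_sum_grow f; have [tG' tsG'] := fringe_sum_grow g.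
  rewrite sum_grow_forest_cons.
  under eq_bigr do rewrite forest_disjoint_sum_cons.
  rewrite 3!big_split /= -mulr_suml -mulr_sumr IHt tG tG' sum_grow_const /=.
  under eq_bigr do rewrite forest_disjoint_sum_cons.
  rewrite 3!big_split /= -mulr_suml -mulr_sumr IHts tsG tsG'.
  rewrite sum_grow_forest_const /=.
  rewrite !forest_disjoint_sum_cons !forest_sum_cons forest_size_cons /=; ring.
Qed.

(** * Mean of a sum over fringe subtrees of one size *)

Definition supported k f := forall t, rtree_size t <> k -> f t = 0.

Lemma eq_fringe_sum f g t : f =1 g -> fringe_sum f t = fringe_sum g t.
Proof. by move=> fg; apply: eq_bigr. Qed.

Lemma eq_disjoint_sum f f' g g' t : f =1 f' -> g =1 g' ->
  disjoint_sum f g t = disjoint_sum f' g' t.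
Proof.
move=> ff' gg'; rewrite /disjoint_sum !(eq_fringe_sum t ff') (eq_fringe_sum t gg').
congr (_ - _); apply: eq_fringe_sum => s.
by rewrite /nested_toll ff' gg' (eq_fringe_sum s ff') (eq_fringe_sum s gg').
Qed.

Lemma fringe_sumZ a f t : fringe_sum (fun s => a * f s) t = a * fringe_sum f t.
Proof. by rewrite /fringe_sum mulr_sumr. Qed.

Lemma disjoint_sumZ a f g t :
  disjoint_sum (fun s => a * f s) g t = a * disjoint_sum f g t.
Proof.
have nested_tollZ :
    nested_toll (fun s => a * f s) g =1 (fun s => a * nested_toll f g s).
  by move=> s; rewrite /nested_toll fringe_sumZ; ring.
rewrite /disjoint_sum fringe_sumZ (eq_fringe_sum t nested_tollZ) fringe_sumZ.
by ring.
Qed.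

Lemma disjoint_sumC f g t : disjoint_sum f g t = disjoint_sum g f t.
Proof.
rewrite /disjoint_sum mulrC; congr (_ - _); apply: eq_fringe_sum => s.
by rewrite /nested_toll; ring.
Qed.

Lemma size_toll_supported k f : supported k f ->
  size_toll f =1 (fun t => k%:R * f t).
Proof.
move=> fk t; rewrite /size_toll.
case: (eqVneq (rtree_size t) k) => [->//|/eqP/fk->].
by rewrite !mulr0.
Qed.

Lemma grow_toll_supported k f : supported k.+1 f -> supported k (grow_toll f).
Proof.
move=> fk t tk; rewrite /grow_toll big_seq big1 // => u /rtree_size_grow uE.
by apply: fk; rewrite uE => -[].
Qed.

Lemma supported0 f : supported 0 f -> f =1 (fun t => 0 * f t).
Proof.
by move=> f0 t; rewrite mul0r f0 //; have := rtree_size_gt0 t; case: rtree_size.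
Qed.

(** The leaf is the only tree of size 1, so its toll is the mean at size 1 and
    is zero for tolls living on larger sizes. *)
Lemma leaf_supported k f :
  supported k.+1 f -> f leaf = (k == 0%N)%:R * mean k.+1 f.
Proof.
case: k => [|k] fk; first by rewrite mul1r mean1.
by rewrite mul0r; apply: fk.
Qed.

Lemma mean_fringe_sum_step k n f : supported k f -> (0 < n)%N ->
  n%:R * mean n.+1 (fringe_sum f) =
  mean n (fringe_sum (grow_toll f)) + n%:R * f leaf
  + (n%:R - k%:R) * mean n (fringe_sum f).
Proof.
move=> fk n0; rewrite mean_step //.
rewrite (@eq_mean _ _ (fun t => fringe_sum (grow_toll f) t + (n%:R * f leaf) * 1
   + (n%:R - k%:R) * fringe_sum f t)) //.
  rewrite !meanD !meanZ; congr (_ + _ + _).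
  by rewrite /mean /expect sumr_const divff ?mulr1 // card_attachments_neq0.
move=> t tn; rewrite (fringe_sum_grow f).1 tn.
by rewrite (eq_fringe_sum t (size_toll_supported fk)) fringe_sumZ; ring.
Qed.

(** Although the value n / (k(k+1)) E_k f is in general wrong at n = k, the recursion from
    n = k to n = k+1 multiplies E_k F by zero, so it starts the induction on [n].
    The induction on [k] starts at the zero toll, where both sides vanish because
    the inverse of 0 is 0. *)
Lemma mean_fringe_sum k n f : supported k f -> (k < n)%N ->
  mean n (fringe_sum f) = n%:R / (k%:R * k.+1%:R) * mean k f.
Proof.
elim: k n f => [|k IH] n f fk kn.
  rewrite mul0r invr0 mulr0 mul0r -[RHS](mean0 n); apply: eq_mean => // t _.
  by rewrite (eq_fringe_sum t (supported0 fk)) fringe_sumZ mul0r.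
(* New fringe subtrees of size k+1 come from growth when k > 0 and are the
   new leaf when k = 0; the rate is given by one formula in both cases. *)
have total_gain j : (k < j)%N ->
    mean j (fringe_sum (grow_toll f)) + j%:R * f leaf =
    j%:R / k.+1%:R * mean k.+1 f.
  move=> kj; rewrite (IH _ _ (grow_toll_supported fk) kj) (leaf_supported fk).
  case: k {IH kn kj} fk => [|k] fk.
    rewrite mul0r invr0 /=; field; nonzero_natr.
  rewrite -mean_step //=; field; nonzero_natr.
elim: n kn => // n IHn; rewrite ltnS => kn.
have n0 : n%:R != 0 :> R by rewrite pnatr_eq0; lia.
apply: (mulfI n0); rewrite (mean_fringe_sum_step fk); last by lia.
rewrite total_gain //; case: (ltngtP k.+1 n) kn => // [kn _|<- _].
  rewrite IHn //; field; nonzero_natr.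
field; nonzero_natr.
Qed.

(** * Mean of a sum over disjoint pairs *)

Lemma mean_disjoint_sum_step k m n f g :
  supported k f -> supported m g -> (0 < n)%N ->
  n%:R * mean n.+1 (disjoint_sum f g) =
  (mean n (disjoint_sum (grow_toll f) g)
   + f leaf * ((n%:R - m%:R) * mean n (fringe_sum g)))
  + (mean n (disjoint_sum (grow_toll g) f)
     + g leaf * ((n%:R - k%:R) * mean n (fringe_sum f)))
  + (n%:R - k%:R - m%:R) * mean n (disjoint_sum f g).
Proof.
move=> fk gm n0; rewrite mean_step // -!meanZ -!meanD.
apply: eq_mean => // t tn; rewrite (disjoint_sum_grow f g).1 tn.
have [fE gE] := (size_toll_supported fk, size_toll_supported gm).
rewrite (eq_fringe_sum t fE) (eq_fringe_sum t gE).
rewrite (eq_disjoint_sum t fE (frefl g)) (disjoint_sumC f (size_toll g)).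
rewrite (eq_disjoint_sum t gE (frefl f)) (disjoint_sumC f (grow_toll g)).
by rewrite !fringe_sumZ !disjoint_sumZ (disjoint_sumC g f); ring.
Qed.

(** Divided by k(k+1)m(m+1), this is the product n^2 / (k(k+1)m(m+1)) coming
    from the two separate means, minus n times [beta R k m]. *)
Definition disjoint_coef k m n : R :=
  n%:R * (n%:R - (k ^ 2 + k * m + m ^ 2 + k + m)%N%:R / (k + m + 1)%N%:R).

Lemma disjoint_coefC k m n : disjoint_coef k m n = disjoint_coef m k n.
Proof.
rewrite /disjoint_coef (_ : k ^ 2 + k * m + m ^ 2 + k + m =
  m ^ 2 + m * k + k ^ 2 + m + k)%N; last by lia.
by rewrite (addnC k).
Qed.

(** The rate at which disjoint pairs appear through their first member: that
    member is grown from size k when k > 0 and is the new leaf when k = 0. The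
    last hypothesis supplies the mean at sizes k and m+1; at k = 0 its right
    side is zero, and the leaf term alone gives the same formula. *)
Lemma mean_disjoint_sum_gain k m n f g : supported k.+1 f -> supported m.+1 g ->
  (k + m.+1 < n)%N ->
  mean n (disjoint_sum (grow_toll f) g) = disjoint_coef k m.+1 n
    / (k%:R * k.+1%:R * m.+1%:R * m.+2%:R) * mean k (grow_toll f) * mean m.+1 g ->
  mean n (disjoint_sum (grow_toll f) g)
    + f leaf * ((n%:R - m.+1%:R) * mean n (fringe_sum g)) =
  disjoint_coef k m.+1 n / (k.+1%:R * m.+1%:R * m.+2%:R)
    * mean k.+1 f * mean m.+1 g.
Proof.
move=> fk gm kmn ->; rewrite (leaf_supported fk) (mean_fringe_sum gm); last by lia.
rewrite /disjoint_coef; case: k fk kmn => [|k] fk kmn.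
  rewrite !mul0r invr0 /=; field; nonzero_natr.
rewrite -mean_step //=; field; nonzero_natr.
Qed.

(** As in [mean_fringe_sum], the recursion from n = k+m to n = k+m+1 has factor
    zero in front of the unknown, so no value at n = k+m is required. The
    formula does fail there: no two disjoint subtrees can use up all the nodes,
    whereas the coefficient is not zero. *)
Lemma mean_disjoint_sum k m n f g :
  supported k f -> supported m g -> (k + m < n)%N ->
  mean n (disjoint_sum f g) = disjoint_coef k m n
    / (k%:R * k.+1%:R * m%:R * m.+1%:R) * mean k f * mean m g.
Proof.
have supported0_sum f' g' t : supported 0 f' -> disjoint_sum f' g' t = 0.
  move=> f0; rewrite (eq_disjoint_sum t (supported0 f0) (frefl g')).
  by rewrite disjoint_sumZ mul0r.
elim: k m n f g => [|k IHk] m n f g fk gm.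
  move=> kmn; rewrite !mul0r invr0 mulr0 !mul0r -[RHS](mean0 n).
  by apply: eq_mean => [|t _]; [lia | apply: supported0_sum].
elim: m n f g fk gm => [|m IHm] n f g fk gm.
  move=> kmn; rewrite mulr0 mul0r invr0 mulr0 !mul0r -[RHS](mean0 n).
  apply: eq_mean => [|t _]; first by lia.
  by rewrite disjoint_sumC; apply: supported0_sum.
elim: n => // n IHn; rewrite ltnS => kmn.
have n0 : n%:R != 0 :> R by rewrite pnatr_eq0; lia.
apply: (mulfI n0); rewrite (mean_disjoint_sum_step fk gm); last by lia.
have kmn1 : (k + m.+1 < n)%N by lia.
have mkn1 : (m + k.+1 < n)%N by lia.
have -> := mean_disjoint_sum_gain fk gm kmn1
  (IHk _ _ _ _ (grow_toll_supported fk) gm kmn1).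
have gain_g : mean n (disjoint_sum (grow_toll g) f) = disjoint_coef m k.+1 n
    / (m%:R * m.+1%:R * k.+1%:R * k.+2%:R) * mean m (grow_toll g) * mean k.+1 f.
  rewrite (@eq_mean _ _ (disjoint_sum f (grow_toll g))) => [|//|t _];
    [|lia|exact: disjoint_sumC].
  rewrite (IHm _ _ _ fk (grow_toll_supported gm)); last by lia.
  rewrite disjoint_coefC mulrAC; congr (_ / _ * _ * _); ring.
have -> := mean_disjoint_sum_gain gm fk mkn1 gain_g.
(* At n = (k+1) + (m+1) both sides are zero, whatever the mean is. *)
have -> : (n%:R - k.+1%:R - m.+1%:R) * mean n (disjoint_sum f g) =
    (n%:R - k.+1%:R - m.+1%:R) * (disjoint_coef k.+1 m.+1 n
    / (k.+1%:R * k.+2%:R * m.+1%:R * m.+2%:R) * mean k.+1 f * mean m.+1 g).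
  move: kmn; rewrite leq_eqVlt => /orP[/eqP <-|/IHn-> //].
  by rewrite natrD; ring.
rewrite /disjoint_coef; field; nonzero_natr.
Qed.

(** * Second moments *)

Lemma fringe_sum_small m f t : supported m f -> (rtree_size t < m)%N ->
  fringe_sum f t = 0.
Proof.
move=> fm; pose Q ts := (forest_size ts < m)%N -> forest_sum f ts = 0.
move: t; suff [//] : (forall t, (rtree_size t < m)%N -> fringe_sum f t = 0)
  /\ (forall ts, Q ts).
apply: rtree_forest_ind => [ts IH lt_m||t ts IHt IHts lt_m].
- rewrite fringe_sum_Node IH ?addr0; last exact: ltnW.
  by apply: fm => eq_m; rewrite eq_m ltnn in lt_m.
- by move=> _; apply: forest_sum_nil.
- move: lt_m; rewrite /forest_size /= => lt_m.
  by rewrite forest_sum_cons IHt ?IHts ?addr0 /forest_size //; lia.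
Qed.

Lemma fringe_sum_top m f t : supported m f -> (rtree_size t <= m)%N ->
  fringe_sum f t = f t.
Proof.
case: t => ts fm le_m; rewrite fringe_sum_Node /forest_sum big_seq big1 ?addr0 //.
move=> t t_ts; apply: (fringe_sum_small fm); apply: leq_trans le_m.
elim: ts t_ts => //= u ts IH; rewrite inE => /predU1P[->|/IH] /=; lia.
Qed.

(** A fringe subtree of size m contains one of size k >= m only if they are
    equal, so only the pairs whose larger member carries [f] matter. *)
Lemma nested_toll_le k m f g : supported k f -> supported m g -> (m <= k)%N ->
  nested_toll f g =1 (fun t => f t * fringe_sum g t).
Proof.
move=> fk gm le_mk t; rewrite /nested_toll.
have [tm|/eqP tm] := eqVneq (rtree_size t) m; last by rewrite gm //; ring.
by rewrite (fringe_sum_top fk) ?tm //; ring.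
Qed.

Lemma mean_mul_fringe_sum k m n f g : supported k f -> supported m g ->
  (m <= k)%N -> (k + m < n)%N ->
  mean n (fun t => fringe_sum f t * fringe_sum g t) =
  mean n (disjoint_sum f g)
  + n%:R / (k%:R * k.+1%:R) * mean k (fun t => f t * fringe_sum g t).
Proof.
move=> fk gm le_mk lt_n.
have nested_k : supported k (fun t => f t * fringe_sum g t).
  by move=> t tk; rewrite fk ?mul0r.
rewrite -(mean_fringe_sum nested_k); last by lia.
rewrite -meanD; apply: eq_mean => [|t _]; first by lia.
rewrite /disjoint_sum (eq_fringe_sum t (nested_toll_le fk gm le_mk)); ring.
Qed.

(** * Copies of a given tree *)

Definition copy_toll v t s : R := (tree_iso v t s)%:R.

Lemma copy_toll_supported v t : supported (rtree_size t) (copy_toll v t).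
Proof.
move=> s st; rewrite /copy_toll.
by case: (boolP (tree_iso v t s)) => // /rtree_size_iso /esym.
Qed.

Lemma fringe_sum_copy v t s :
  fringe_sum (copy_toll v t) s = (num_copies v t s)%:R.
Proof.
rewrite /num_copies -sum1_count natr_sum [RHS]big_mkcond; apply: eq_bigr => u _.
by rewrite /copy_toll; case: tree_iso.
Qed.

Lemma mean_copy v k t : mean k (copy_toll v t) = rrt_prob R v k t.
Proof.
rewrite /mean /expect /rrt_prob /prob -sum1_card natr_sum [in RHS]big_mkcond.
congr (_ / _); apply: eq_bigr => w _.
by rewrite /copy_toll inE tree_iso_sym; case: tree_iso.
Qed.

Lemma cov_mean n f g : cov (fun w : attachments n.-1 => f (@rrt n w))
    (fun w => g (@rrt n w)) =
  mean n (fun t => f t * g t) - mean n f * mean n g.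
Proof.
rewrite /cov -/(mean n f) -/(mean n g).
pose h t := f t * g t + - mean n g * f t + - mean n f * g t
  + mean n f * mean n g * 1.
transitivity (mean n h).
  by congr (_ / _); apply: eq_bigr => w _; rewrite /h; ring.
rewrite !meanD !meanZ.
have -> : mean n (fun=> 1) = 1.
  by rewrite /mean /expect sumr_const divff // card_attachments_neq0.
ring.
Qed.

End Moments.

Theorem theorem1p13 (R : realFieldType) (v : tree_version)
    (t t' : rtree) (k m n : nat)
    (size_t : rtree_size t = k) (size_t' : rtree_size t' = m)
    (m_bounds : (1 <= m <= k)%N) (n_large : (k + m < n)%N) :
  cov (rrt_copies R v (n := n) t) (rrt_copies R v (n := n) t') =
  n%:R * sigma R v k m t t'.
Proof.
have fk : supported k (copy_toll R v t).
  by rewrite -size_t; apply: copy_toll_supported.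
have gm : supported m (copy_toll R v t').
  by rewrite -size_t'; apply: copy_toll_supported.
case/andP: m_bounds => m_gt0 le_mk.
have copiesE u (w : attachments n.-1) :
  rrt_copies R v (n := n) u w = fringe_sum (copy_toll R v u) (@rrt n w).
  by rewrite fringe_sum_copy.
have expectE u : expect (rrt_copies R v (n := n) u) =
    mean n (fringe_sum (copy_toll R v u)).
  by congr (_ / _); apply: eq_bigr => w _.
have -> : cov (rrt_copies R v (n := n) t) (rrt_copies R v (n := n) t') =
    cov (fun w => fringe_sum (copy_toll R v t) (@rrt n w))
        (fun w => fringe_sum (copy_toll R v t') (@rrt n w)).
  rewrite /cov !expectE; congr (_ / _); apply: eq_bigr => w _.
  by rewrite !copiesE.
rewrite cov_mean (mean_mul_fringe_sum fk gm le_mk n_large).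
rewrite (mean_disjoint_sum fk gm n_large).
rewrite (mean_fringe_sum fk); last by lia.
rewrite (mean_fringe_sum gm); last by lia.
have -> : mean k (fun s => copy_toll R v t s * fringe_sum (copy_toll R v t') s) =
    (num_copies v t' t)%:R * mean k (copy_toll R v t).
  rewrite -meanZ; apply: eq_mean => [|s _]; first by lia.
  (* Isomorphic trees contain equally many copies of [t']. *)
  rewrite fringe_sum_copy /copy_toll.
  case: (boolP (tree_iso v t s)) => [/num_copies_iso->|_]; first exact: mulrC.
  by rewrite mul0r mulr0.
rewrite !mean_copy /sigma /beta /disjoint_coef.
case: k m m_gt0 le_mk {fk gm n_large size_t size_t'} => [|k] [|m] //= _ _.
field; nonzero_natr.
Qed.
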